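(* (Weak coassociativity.) Let $M$ be a comodule over a graded vertex coalgebra $V$ and let $v'\in(V\otimes V\otimes M)'$. There exists $k\in\mathbb{Z}_+$ such that $$(x_0+x_2)^k\left\langle v',\,(\mathcal{Y}_V(x_0)\otimes Id_M)\mathcal{Y}_M(x_2)w-(Id_V\otimes\mathcal{Y}_M(x_2))\mathcal{Y}_M(x_0+x_2)w\right\rangle=0$$ for any $w\in M$.
   Context: All vector spaces are over a field $\mathbb{F}$ of characteristic $0$; $x,x_0,x_1,x_2$ are commuting formal variables; $\mathbb{Z}_+$ is the set of positive integers. $\delta(x)=\sum_{n\in\mathbb{Z}}x^n$. For $n\in\mathbb{Z}$, $(x_i\pm x_j)^n$ is expanded in nonnegative integral powers of the second listed variable $x_j$ (this also applies inside $\delta$ and to $\mathcal{Y}_M(x_0+x_2)$). $W[[x,x^{-1}]]$ is the space of all doubly infinite formal series with coefficients in $W$, and $W((x^{-1}))$ is the space of those with only finitely many positive powers of $x$. $T(u\otimes v)=v\otimes u$ on $V\otimes V$. Linear maps and pairings act on formal series coefficientwise. A vertex coalgebra $(V,\mathcal{Y}_V,c)$ is a vector space $V$ with linear maps $\mathcal{Y}_V(x):V\to(V\otimes V)[[x,x^{-1}]]$ and $c:V\to\mathbb{F}$ such that for all $v\in V$: (left counit) $(c\otimes Id_V)\mathcal{Y}_V(x)v=v$; (cocreation) $(Id_V\otimes c)\mathcal{Y}_V(x)v\in V[[x]]$ and $\lim_{x\to0}(Id_V\otimes c)\mathcal{Y}_V(x)v=v$; (truncation) $\mathcal{Y}_V(x)v\in(V\otimes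 V)((x^{-1}))$; (Jacobi identity) $$x_0^{-1}\delta\left(\tfrac{x_1-x_2}{x_0}\right)(Id_V\otimes\mathcal{Y}_V(x_2))\mathcal{Y}_V(x_1)-x_0^{-1}\delta\left(\tfrac{x_2-x_1}{-x_0}\right)(T\otimes Id_V)(Id_V\otimes\mathcal{Y}_V(x_1))\mathcal{Y}_V(x_2)=x_2^{-1}\delta\left(\tfrac{x_1-x_0}{x_2}\right)(\mathcal{Y}_V(x_0)\otimes Id_V)\mathcal{Y}_V(x_2).$$ It is a graded vertex coalgebra if $V=\coprod_{k\in\mathbb{Z}}V_{(k)}$ is $\mathbb{Z}$-graded with $V_{(k)}=0$ for $k$ sufficiently negative and, writing $\mathcal{Y}_V(x)v=\sum_{k\in\mathbb{Z}}\Delta_k(v)x^{-k-1}$, $\Delta_k(v)\in(V\otimes V)_{(r+k+1)}$ for all $v\in V_{(r)}$, $r,k\in\mathbb{Z}$. A comodule over a graded vertex coalgebra $V$ is a $\mathbb{Q}$-graded vector space $M=\coprod_{j\in\mathbb{Q}}M_{(j)}$ with $M_{(j)}=0$ for $j$ sufficiently negative, equipped with a linear map $\mathcal{Y}_M(x):M\to(V\otimes M)[[x,x^{-1}]]$ such that, writing $\mathcal{Y}_M(x)w=\sum_{k\in\mathbb{Z}}\Delta_k(w)x^{-k-1}$, $\Delta_k(w)\in(V\otimes M)_{(j+k+1)}$ for $w\in M_{(j)}$, and for all $w\in M$: 1. Left counit: $(c\otimes Id_M)\mathcal{Y}_M(x)w=w$. 2. Truncation: $\mathcal{Y}_M(x)w\in(V\otimes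 M)((x^{-1}))$. 3. Jacobi identity: $$x_0^{-1}\delta\left(\tfrac{x_1-x_2}{x_0}\right)(Id_V\otimes\mathcal{Y}_M(x_2))\mathcal{Y}_M(x_1)-x_0^{-1}\delta\left(\tfrac{x_2-x_1}{-x_0}\right)(T\otimes Id_M)(Id_V\otimes\mathcal{Y}_M(x_1))\mathcal{Y}_M(x_2)=x_2^{-1}\delta\left(\tfrac{x_1-x_0}{x_2}\right)(\mathcal{Y}_V(x_0)\otimes Id_M)\mathcal{Y}_M(x_2).$$ For a graded space $W=\coprod_k W_{(k)}$, the graded dual is $W'=\coprod_k\mathrm{Hom}(W_{(k)},\mathbb{F})$, and $\langle\cdot,\cdot\rangle$ is the natural pairing of $W'$ with $W$. Tensor products are graded by total weight. *)

(* Defs.v *)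
From HB Require Import structures.
From mathcomp Require Import all_boot all_order all_algebra.
From mathcomp Require Import finmap.
From mathcomp Require Import all_classical.

Set Implicit Arguments.
Unset Strict Implicit.
Unset Printing Implicit Defensive.

Import Order.TTheory GRing.Theory Num.Theory.

Local Open Scope classical_set_scope.
Local Open Scope ring_scope.

Section TensorDef.
Variables (F : fieldType) (V W : lmodType F).

Definition tens_eval (U : lmodType F) (f : V -> W -> U) (s : seq (V * W)) : U :=
  \sum_(p <- s) f p.1 p.2.

(* A list of pairs stands for the formal sum of the corresponding pure tensors
   (scalars are absorbed in the first components); two formal sums are
   identified when no bilinear map separates them. *)
Definition tens_equiv (s t : seq (V * W)) : bool :=
  `[< forall (U : lmodType F) (f : V -> W -> U),
        bilinear_for *:%R *:%R f -> tens_eval f s = tens_eval f t >].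

Lemma tens_equiv_refl : reflexive tens_equiv.
Proof. by move=> s; apply/asboolP. Qed.

Lemma tens_equiv_sym : symmetric tens_equiv.
Proof.
by move=> s t; apply/asboolP/asboolP => h U f bf; rewrite (h U f bf).
Qed.

Lemma tens_equiv_trans : transitive tens_equiv.
Proof.
move=> t s r /asboolP st /asboolP tr; apply/asboolP => U f bf.
by rewrite (st U f bf) (tr U f bf).
Qed.

Canonical tens_equiv_equiv :=
  EquivRel tens_equiv tens_equiv_refl tens_equiv_sym tens_equiv_trans.

Definition tensor : Type := {eq_quot tens_equiv}%qT.
HB.instance Definition _ := Choice.on tensor.
HB.instance Definition _ := EqQuotient.on tensor.

Definition tpi (s : seq (V * W)) : tensor := (\pi_tensor s)%qT.

Lemma tpiP s t : tpi s = tpi t <->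
  (forall (U : lmodType F) (f : V -> W -> U),
     bilinear_for *:%R *:%R f -> tens_eval f s = tens_eval f t).
Proof.
rewrite /tpi; split => [/eqP|h]; last first.
  by apply/eqP; rewrite -[_ == _]/(_ == _ %[mod_eq _])%qT eqmodE; apply/asboolP.
by rewrite -[_ == _]/(_ == _ %[mod_eq _])%qT eqmodE => /asboolP.
Qed.

Lemma reprtK (x : tensor) : tpi (repr x) = x.
Proof. by rewrite /tpi reprK. Qed.

Lemma tens_eval_cat U f s t :
  @tens_eval U f (s ++ t) = tens_eval f s + tens_eval f t.
Proof. by rewrite /tens_eval big_cat. Qed.

Definition sscale (a : F) (s : seq (V * W)) := [seq (a *: p.1, p.2) | p <- s].

Lemma tens_eval_scale U f a s : bilinear_for *:%R *:%R f ->
  @tens_eval U f (sscale a s) = a *: tens_eval f s.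
Proof.
move=> bf; rewrite /tens_eval big_map scaler_sumr; apply: eq_bigr => p _ /=.
exact: (scalable_linear (bf.1 p.2)).
Qed.

Definition tadd (x y : tensor) : tensor := tpi (repr x ++ repr y).
Definition tscale (a : F) (x : tensor) : tensor := tpi (sscale a (repr x)).
Definition topp (x : tensor) : tensor := tscale (-1) x.
Definition tzero : tensor := tpi [::].

Lemma eval_repr (U : lmodType F) (f : V -> W -> U) s : bilinear_for *:%R *:%R f ->
  tens_eval f (repr (tpi s)) = tens_eval f s.
Proof. by move: U f; apply/tpiP; rewrite reprtK. Qed.

Lemma tensor_eqP (x y : tensor) :
  (forall (U : lmodType F) (f : V -> W -> U), bilinear_for *:%R *:%R f ->
     tens_eval f (repr x) = tens_eval f (repr y)) -> x = y.
Proof. by move=> h; rewrite -(reprtK x) -(reprtK y); apply/tpiP. Qed.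

Lemma eval_add (U : lmodType F) (f : V -> W -> U) x y : bilinear_for *:%R *:%R f ->
  tens_eval f (repr (tadd x y)) = tens_eval f (repr x) + tens_eval f (repr y).
Proof. by move=> bf; rewrite eval_repr// tens_eval_cat. Qed.

Lemma eval_scale (U : lmodType F) (f : V -> W -> U) a x : bilinear_for *:%R *:%R f ->
  tens_eval f (repr (tscale a x)) = a *: tens_eval f (repr x).
Proof. by move=> bf; rewrite eval_repr// tens_eval_scale. Qed.

Lemma eval_zero (U : lmodType F) (f : V -> W -> U) : bilinear_for *:%R *:%R f ->
  tens_eval f (repr tzero) = 0.
Proof. by move=> bf; rewrite eval_repr// /tens_eval big_nil. Qed.

Fact taddA : associative tadd.
Proof. by move=> x y z; apply: tensor_eqP => U f bf; rewrite !eval_add// addrA. Qed.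
Fact taddC : commutative tadd.
Proof. by move=> x y; apply: tensor_eqP => U f bf; rewrite !eval_add// addrC. Qed.
Fact tadd0 : left_id tzero tadd.
Proof.
by move=> x; apply: tensor_eqP => U f bf; rewrite eval_add// eval_zero// add0r.
Qed.
Fact taddN : left_inverse tzero topp tadd.
Proof.
move=> x; apply: tensor_eqP => U f bf; rewrite eval_add// eval_zero//.
by rewrite eval_scale// scaleN1r addNr.
Qed.

HB.instance Definition _ :=
  GRing.isZmodule.Build tensor taddA taddC tadd0 taddN.

Fact tscaleA a b x : tscale a (tscale b x) = tscale (a * b) x.
Proof. by apply: tensor_eqP => U f bf; rewrite !eval_scale// scalerA. Qed.
Fact tscale1 : left_id 1 tscale.
Proof. by move=> x; apply: tensor_eqP => U f bf; rewrite eval_scale// scale1r. Qed.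
Fact tscaleDr : right_distributive tscale +%R.
Proof.
move=> a x y; apply: tensor_eqP => U f bf.
by rewrite eval_scale// !eval_add// !eval_scale// scalerDr.
Qed.
Fact tscaleDl x : {morph tscale^~ x : a b / a + b}.
Proof.
move=> a b; apply: tensor_eqP => U f bf.
by rewrite eval_add// !eval_scale// scalerDl.
Qed.

HB.instance Definition _ := GRing.Zmodule_isLmodule.Build F tensor
  tscaleA tscale1 tscaleDr tscaleDl.

Definition tpure (v : V) (w : W) : tensor := tpi [:: (v, w)].

Definition tlift (U : lmodType F) (f : V -> W -> U)
  (bf : bilinear_for *:%R *:%R f) (x : tensor) : U := tens_eval f (repr x).

Lemma tlift_linear (U : lmodType F) f bf : linear (@tlift U f bf).
Proof. by move=> a x y; rewrite /tlift eval_add// eval_scale. Qed.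

HB.instance Definition _ (U : lmodType F) f bf :=
  GRing.isLinear.Build F tensor U *:%R (@tlift U f bf) (@tlift_linear U f bf).

Lemma tliftE (U : lmodType F) f bf v w : @tlift U f bf (tpure v w) = f v w.
Proof. by rewrite /tlift eval_repr// /tens_eval big_seq1. Qed.

Lemma tpure_bilinear : bilinear_for *:%R *:%R tpure.
Proof.
by split=> [w|v] a x y; apply: tensor_eqP => U f bf;
   rewrite eval_add// eval_scale// !eval_repr// /tens_eval !big_seq1 /=;
   [exact: bf.1 | exact: bf.2].
Qed.

Lemma tensor_sum (x : tensor) : x = \sum_(p <- repr x) tpure p.1 p.2.
Proof.
rewrite -[LHS]reprtK; elim: (repr x) => [|p s ih]; first by rewrite big_nil.
rewrite big_cons -ih; apply: tensor_eqP => U f bf.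
by rewrite eval_add// !eval_repr// /tens_eval big_cons big_seq1.
Qed.

Theorem tensor_universal (U : lmodType F) (f : V -> W -> U) :
  bilinear_for *:%R *:%R f ->
  exists g : {linear tensor -> U}, (forall v w, g (tpure v w) = f v w) /\
    (forall h : {linear tensor -> U},
       (forall v w, h (tpure v w) = f v w) -> h =1 g).
Proof.
move=> bf; exists (tlift bf); split=> [v w|h hf x]; first exact: tliftE.
rewrite [x]tensor_sum !linear_sum; apply: eq_bigr => p _ /=.
by rewrite hf tliftE.
Qed.

End TensorDef.

Reserved Notation "V ⊗ W" (at level 40, left associativity).
Notation "V ⊗ W" := (tensor V W).
Reserved Notation "v ⊗ₜ w" (at level 40, left associativity).
Notation "v ⊗ₜ w" := (tpure v w).

Lemma tensor_ext (F : fieldType) (V W U : lmodType F)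
    (g h : {linear V ⊗ W -> U}) :
  (forall v w, g (v ⊗ₜ w) = h (v ⊗ₜ w)) -> g =1 h.
Proof.
move=> gh x; rewrite [x]tensor_sum !linear_sum; apply: eq_bigr => p _ /=.
exact: gh.
Qed.

Section TensorMaps.
Variable F : fieldType.

Lemma pureDl (V W : lmodType F) (a : F) (v v' : V) (w : W) :
  (a *: v + v') ⊗ₜ w = a *: (v ⊗ₜ w) + v' ⊗ₜ w.
Proof. exact: (tpure_bilinear V W).1. Qed.

Lemma pureDr (V W : lmodType F) (a : F) (v : V) (w w' : W) :
  v ⊗ₜ (a *: w + w') = a *: (v ⊗ₜ w) + v ⊗ₜ w'.
Proof. exact: (tpure_bilinear V W).2. Qed.

Lemma mk_bilinear (V W U : lmodType F) (f : V -> W -> U) :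
  (forall a x y w, f (a *: x + y) w = a *: f x w + f y w) ->
  (forall v a x y, f v (a *: x + y) = a *: f v x + f v y) ->
  bilinear_for *:%R *:%R f.
Proof. by move=> fl fr; split=> [w|v] a x y; [exact: fl | exact: fr]. Qed.

Section Map.
Variables (V V' W W' : lmodType F) (f : {linear V -> V'}) (g : {linear W -> W'}).

Lemma tmap_bilinear :
  bilinear_for *:%R *:%R (fun v w => f v ⊗ₜ g w).
Proof. by split=> [w|v] a x y; rewrite linearP (pureDl, pureDr). Qed.

Definition tmap : {linear V ⊗ W -> V' ⊗ W'} := tlift tmap_bilinear.

Lemma tmapE v w : tmap (v ⊗ₜ w) = f v ⊗ₜ g w.
Proof. exact: tliftE. Qed.

End Map.

Section Unitors.
Variable V : lmodType F.

Lemma tlunit_bilinear : bilinear_for *:%R *:%R (fun (a : F^o) (v : V) => a *: v).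
Proof.
split=> [v|b] a x y; first by rewrite /= scalerDl scalerA.
by rewrite /= scalerDr !scalerA mulrC.
Qed.

Definition tlunit : {linear F^o ⊗ V -> V} := tlift tlunit_bilinear.

Lemma tlunitE (a : F^o) v : tlunit (a ⊗ₜ v) = a *: v.
Proof. exact: (tliftE tlunit_bilinear). Qed.

Lemma trunit_bilinear : bilinear_for *:%R *:%R (fun (v : V) (a : F^o) => a *: v).
Proof.
split=> [b|v] a x y; last by rewrite /= scalerDl scalerA.
by rewrite /= scalerDr !scalerA mulrC.
Qed.

Definition trunit : {linear V ⊗ F^o -> V} := tlift trunit_bilinear.

Lemma trunitE v (a : F^o) : trunit (v ⊗ₜ a) = a *: v.
Proof. exact: (tliftE trunit_bilinear). Qed.

End Unitors.

Section Twist.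
Variables V W : lmodType F.

Lemma ttwist_bilinear : bilinear_for *:%R *:%R (fun (v : V) (w : W) => w ⊗ₜ v).
Proof. by split=> [w|v] a x y; rewrite (pureDl, pureDr). Qed.

Definition ttwist : {linear V ⊗ W -> W ⊗ V} := tlift ttwist_bilinear.

Lemma ttwistE v w : ttwist (v ⊗ₜ w) = w ⊗ₜ v.
Proof. exact: tliftE. Qed.

End Twist.

Section Assoc.
Variables U V W : lmodType F.

Lemma tassoc1_bilinear (u : U) :
  bilinear_for *:%R *:%R (fun (v : V) (w : W) => u ⊗ₜ v ⊗ₜ w).
Proof. by split=> [w|v] a x y; rewrite ?pureDr ?pureDl. Qed.

Lemma tassoc_bilinear :
  bilinear_for *:%R *:%R (fun (u : U) (t : V ⊗ W) => tlift (tassoc1_bilinear u) t).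
Proof.
apply: mk_bilinear => [a x y t|u a x y]; last by rewrite linearP.
rewrite (tensor_sum t); elim: (repr t) => [|p s ih].
  by rewrite big_nil !linear0 addr0.
by rewrite big_cons !linearD /= ih !tliftE !pureDl addrACA.
Qed.

(* The canonical isomorphism U ⊗ (V ⊗ W) = (U ⊗ V) ⊗ W. *)
Definition tassoc : {linear U ⊗ (V ⊗ W) -> U ⊗ V ⊗ W} := tlift tassoc_bilinear.

Lemma tassocE u v w : tassoc (u ⊗ₜ (v ⊗ₜ w)) = u ⊗ₜ v ⊗ₜ w.
Proof. by rewrite [LHS]tliftE tliftE. Qed.

End Assoc.

End TensorMaps.

Section Subspace.
Variables (F : fieldType) (W : lmodType F) (S : submodClosed W).

Record subspace := Subspace { subspace_val :> W; _ : subspace_val \in S }.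
HB.instance Definition _ := [isSub for subspace_val].
HB.instance Definition _ := [Choice of subspace by <:].
HB.instance Definition _ := [SubChoice_isSubLmodule of subspace by <:].

End Subspace.

Section Span.
Variables (F : fieldType) (W : lmodType F).

Definition span_of (A : set W) : {pred W} :=
  [pred x | `[< exists s : seq (F * W),
     (forall p, p \in s -> A p.2) /\ x = \sum_(p <- s) p.1 *: p.2 >]].

Lemma span_of_closed A : subsemimod_closed (span_of A).
Proof.
apply: GRing.submod_closed_semi; split=> [|a x y /asboolP[s [sA ->]] /asboolP[t [tA ->]]].
  by apply/asboolP; exists [::]; rewrite big_nil.
apply/asboolP; exists ([seq (a * p.1, p.2) | p <- s] ++ t); split=> [p|].
  by rewrite mem_cat => /orP[/mapP[q /sA Aq ->]//|/tA].
rewrite big_cat big_map scaler_sumr; congr (_ + _).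
by apply: eq_bigr => p _; rewrite scalerA.
Qed.

HB.instance Definition _ A :=
  GRing.isSubmodClosed.Build F W (span_of A) (span_of_closed A).

Lemma mem_span_of (A : set W) x : A x -> x \in span_of A.
Proof.
by move=> Ax; apply/asboolP; exists [:: (1, x)]; split=> [p|];
   rewrite ?mem_seq1 ?big_seq1 ?scale1r// => /eqP->.
Qed.

End Span.

Section Grading.
Variables (F : fieldType) (I : choiceType) (W : lmodType F).

(* W is the direct sum of the subspaces [piece k] *)
Record grading := Grading {
  piece :> I -> submodClosed W;
  gradingP : forall w : W, exists! c : (forall k, subspace (piece k)),
    finite_set [set k | c k != 0] /\ w = \sum_(k \in setT) val (c k)
}.

Definition component (G : grading) (k : I) (w : W) : subspace (G k) :=
  sval (cid (gradingP G w)) k.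

(* An element of the coproduct of the spaces Hom(W_(k), F). *)
Record graded_dual (G : grading) := GradedDual {
  dual_fun :> forall k, {linear subspace (G k) -> F^o};
  dual_finite : finite_set [set k | exists w, dual_fun k w != 0]
}.

Definition pairing (G : grading) (f : graded_dual G) (w : W) : F^o :=
  \sum_(k \in setT) f k (component G k w).

End Grading.

Lemma big_pred1_seq (I : eqType) (U : nmodType) (s : seq I) (k : I) (f : I -> U) :
  uniq s -> k \in s -> \sum_(i <- s | i == k) f i = f k.
Proof.
by move=> us ks; rewrite -big_filter (@filter_pred1_uniq _ s k)// big_seq1.
Qed.

Section GradingTheory.
Variables (F : fieldType) (I : choiceType) (W : lmodType F).

Lemma fin_suppP (P : I -> submodClosed W) (c : forall k, subspace (P k)) :
  finite_set [set k | c k != 0] <->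
  exists A : {fset I}, forall k, k \notin A -> c k = 0.
Proof.
split=> [/finite_fsetP[A eA]|[A cA]].
  exists A => k kA; apply/eqP; apply: contraNT kA => ck.
  by have : [set k | c k != 0] k by []; rewrite eA.
apply: (sub_finite_set _ (finite_fset A)) => k /= ck.
by apply: contraNT ck => /cA ->.
Qed.

Variable G : grading I W.

Lemma component_supp w : exists A : {fset I},
  (forall k, k \notin A -> component G k w = 0) /\
  w = \sum_(k <- A) val (component G k w).
Proof.
have [[/fin_suppP[A cA] wE] _] := svalP (cid (gradingP G w)).
exists A; split=> //; rewrite [LHS]wE; apply: fsbigTE => k /cA.
by rewrite /component => ->.
Qed.

Lemma component_uniq w (c : forall k, subspace (G k)) (A : {fset I}) :
  (forall k, k \notin A -> c k = 0) -> w = \sum_(k <- A) val (c k) ->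
  forall k, component G k w = c k.
Proof.
move=> cA wE k; have [_ h] := svalP (cid (gradingP G w)).
rewrite /component (h c)//; split; first by apply/fin_suppP; exists A.
by rewrite wE; apply/esym/fsbigTE => j /cA ->.
Qed.

Lemma component_sum (A : {fset I}) w :
  (forall k, k \notin A -> component G k w = 0) ->
  w = \sum_(k <- A) val (component G k w).
Proof.
move=> wA; have [B [wB wE]] := component_supp w; rewrite [LHS]wE.
transitivity (\sum_(k \in setT) val (component G k w)).
  by apply/esym/fsbigTE => k /wB ->.
by apply/fsbigTE => k /wA ->.
Qed.

Lemma component_supp2 x y : exists A : {fset I},
  (forall k, k \notin A -> component G k x = 0) /\
  (forall k, k \notin A -> component G k y = 0).
Proof.
have [A [xA _]] := component_supp x; have [B [yB _]] := component_supp y.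
by exists (A `|` B)%fset; split=> k; rewrite in_fsetU negb_or => /andP[];
  [move/xA | move=> _ /yB].
Qed.

Lemma component_linear k : linear (component G k).
Proof.
move=> a x y; have [A [xA yA]] := component_supp2 x y.
apply: (@component_uniq _ (fun k => a *: component G k x + component G k y) A).
  by move=> j jA; rewrite xA// yA// scaler0 addr0.
rewrite {1}(component_sum xA) {1}(component_sum yA).
by rewrite scaler_sumr -big_split.
Qed.

HB.instance Definition _ k :=
  GRing.isLinear.Build F W (subspace (G k)) *:%R (component G k) (component_linear k).

Lemma component_piece k w : w \in G k ->
  forall j, val (component G j w) = if j == k then w else 0.
Proof.
move=> wk j.
have cP i : (if i == k then w else 0) \in G i.
  by case: eqP => [->|_]; rewrite ?rpred0.
rewrite (@component_uniq w (fun i => Subspace (cP i)) [fset k]%fset)//.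
  by move=> i; rewrite in_fset1 => ik; apply: val_inj; rewrite /= (negbTE ik).
by rewrite big_seq_fset1 /= eqxx.
Qed.

End GradingTheory.

Section MkGrading.
Variables (F : fieldType) (I : choiceType) (W : lmodType F).
Variables (P : I -> submodClosed W) (pr : I -> {linear W -> W}).
Hypothesis prE : forall k j x, x \in P j -> pr k x = if j == k then x else 0.
Hypothesis Psum : forall w, exists s : seq (I * W),
  (forall p, p \in s -> p.2 \in P p.1) /\ w = \sum_(p <- s) p.2.

Lemma mk_gradingP (w : W) : exists! c : (forall k, subspace (P k)),
  finite_set [set k | c k != 0] /\ w = \sum_(k \in setT) val (c k).
Proof.
have [s [sP wE]] := Psum w.
have prs k : pr k w = \sum_(p <- s | p.1 == k) p.2.
  rewrite wE linear_sum big_seq [RHS]big_mkcond [RHS]big_seq.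
  by apply: eq_bigr => p ps; rewrite (prE k (sP p ps)).
have prP k : pr k w \in P k.
  rewrite prs big_seq_cond; apply: rpred_sum => p /andP[ps /eqP <-]; exact: sP.
pose A : {fset I} := seq_fset tt [seq p.1 | p <- s].
have prA k : k \notin A -> pr k w = 0.
  move=> kA; rewrite prs big_seq_cond big1// => p /andP[ps /eqP pk].
  by case/negP: kA; rewrite seq_fsetE -pk map_f.
exists (fun k => Subspace (prP k)); split; [split|].
- by apply/fin_suppP; exists A => k /prA pk; apply: val_inj.
- rewrite (fsbigTE A) => [|k /prA//] /=.
  under eq_bigr do rewrite prs big_mkcond.
  rewrite exchange_big {1}wE big_seq [RHS]big_seq; apply: eq_bigr => p ps /=.
  rewrite -big_mkcond; under eq_bigl do rewrite eq_sym.
  by rewrite (@big_pred1_seq _ _ A) ?fset_uniq ?seq_fsetE ?map_f.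
- move=> c [/fin_suppP[B cB] cE]; apply: functional_extensionality_dep => k.
  apply: val_inj; rewrite /= {prs prP prA wE sP s A} cE (fsbigTE B); last by move=> j /cB ->.
  rewrite linear_sum /=; under eq_bigr => j _ do rewrite (prE k (valP (c j))).
  rewrite -big_mkcond; case: (boolP (k \in B)) => kB.
    by rewrite (@big_pred1_seq _ _ B) ?fset_uniq.
  rewrite cB// big_seq_cond big1// => j /andP[jB /eqP jk].
  by rewrite jk (negbTE kB) in jB.
Qed.

End MkGrading.

Section TensorGrading.
Variables (F : fieldType) (I J K : choiceType) (V W : lmodType F).
Variables (wt : I -> J -> K) (GV : grading I V) (GW : grading J W).

(* The sum of the subspaces V_(i) ⊗ W_(j) over all i, j of total weight k. *)
Definition tensor_piece (k : K) : submodClosed (V ⊗ W) :=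
  span_of [set t | exists i j v w,
    [/\ wt i j = k, v \in GV i, w \in GW j & t = v ⊗ₜ w]].

Lemma pure0l (w : W) : (0 : V) ⊗ₜ w = 0.
Proof.
by have := pureDl (-1) (0 : V) 0 w; rewrite !scaleN1r oppr0 addr0 addNr.
Qed.

Lemma pure0r (v : V) : v ⊗ₜ (0 : W) = 0.
Proof.
by have := pureDr (-1) v (0 : W) 0; rewrite !scaleN1r oppr0 addr0 addNr.
Qed.

Lemma pure_suml T (s : seq T) (f : T -> V) (w : W) :
  (\sum_(i <- s) f i) ⊗ₜ w = \sum_(i <- s) f i ⊗ₜ w.
Proof.
elim: s => [|i s ih]; rewrite ?big_nil ?pure0l// !big_cons -ih.
by rewrite -[f i in LHS]scale1r pureDl scale1r.
Qed.

Lemma pure_sumr T (s : seq T) (f : T -> W) (v : V) :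
  v ⊗ₜ (\sum_(i <- s) f i) = \sum_(i <- s) v ⊗ₜ f i.
Proof.
elim: s => [|i s ih]; rewrite ?big_nil ?pure0r// !big_cons -ih.
by rewrite -[f i in LHS]scale1r pureDr scale1r.
Qed.

Definition tproj_fun k (v : V) (w : W) : V ⊗ W :=
  \sum_(i \in setT) \sum_(j \in setT)
    if wt i j == k then val (component GV i v) ⊗ₜ val (component GW j w) else 0.

Lemma tproj_funE k (A : {fset I}) (B : {fset J}) v w :
  (forall i, i \notin A -> component GV i v = 0) ->
  (forall j, j \notin B -> component GW j w = 0) ->
  tproj_fun k v w = \sum_(i <- A) \sum_(j <- B)
    if wt i j == k then val (component GV i v) ⊗ₜ val (component GW j w) else 0.
Proof.
move=> vA wB; rewrite /tproj_fun (fsbigTE A) => [|i /vA ->]; last first.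
  by rewrite fsbig1// => j _; rewrite /= pure0l if_same.
by apply: eq_bigr => i _; apply: fsbigTE => j /wB ->; rewrite /= pure0r if_same.
Qed.

Lemma tproj_bilinear k : bilinear_for *:%R *:%R (tproj_fun k).
Proof.
apply: mk_bilinear => [a x y w|v a x y].
- have [A [xA yA]] := component_supp2 GV x y.
  have [B [wB _]] := component_supp GW w.
  rewrite (tproj_funE k xA wB) (tproj_funE k yA wB).
  rewrite (tproj_funE (A := A) k _ wB) => [|i iA]; last first.
    by rewrite linearP /= xA// yA// scaler0 addr0.
  rewrite scaler_sumr -big_split; apply: eq_bigr => i _ /=.
  rewrite scaler_sumr -big_split; apply: eq_bigr => j _ /=.
  by case: ifP => _; rewrite ?scaler0 ?addr0// linearP /= pureDl.
- have [A [vA _]] := component_supp GV v.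
  have [B [xB yB]] := component_supp2 GW x y.
  rewrite (tproj_funE k vA xB) (tproj_funE k vA yB).
  rewrite (tproj_funE (B := B) k vA) => [|i iA]; last first.
    by rewrite linearP /= xB// yB// scaler0 addr0.
  rewrite scaler_sumr -big_split; apply: eq_bigr => i _ /=.
  rewrite scaler_sumr -big_split; apply: eq_bigr => j _ /=.
  by case: ifP => _; rewrite ?scaler0 ?addr0// linearP /= pureDr.
Qed.

Lemma tproj_piece k j x : x \in tensor_piece j ->
  tlift (tproj_bilinear k) x = if j == k then x else 0.
Proof.
move=> /asboolP[s [sP ->]]; rewrite linear_sum big_seq.
transitivity (\sum_(p <- s | p \in s) if j == k then p.1 *: p.2 else 0).
  apply: eq_bigr => p /sP[a [b [v [w [<- va wb ->]]]]].
  rewrite linearZ /= tliftE (@tproj_funE _ [fset a]%fset [fset b]%fset).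
  - rewrite !big_seq_fset1 (component_piece va) (component_piece wb) !eqxx.
    by case: ifP; rewrite ?scaler0.
  - move=> i; rewrite in_fset1 => ia; apply: val_inj.
    by rewrite (component_piece va) (negbTE ia).
  - move=> i; rewrite in_fset1 => ia; apply: val_inj.
    by rewrite (component_piece wb) (negbTE ia).
by rewrite -big_seq; case: ifP => // _; rewrite big1.
Qed.

Lemma tensor_piece_sum (x : V ⊗ W) : exists s : seq (K * (V ⊗ W)),
  (forall p, p \in s -> p.2 \in tensor_piece p.1) /\ x = \sum_(p <- s) p.2.
Proof.
rewrite (tensor_sum x); elim: (repr x) => [|[v w] l [s [sP sE]]].
  by exists [::]; split=> //; rewrite !big_nil.
have [A [_ vE]] := component_supp GV v; have [B [_ wE]] := component_supp GW w.
exists ([seq (wt i j, val (component GV i v) ⊗ₜ val (component GW j w))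
          | i <- A, j <- B] ++ s); split=> [p|].
  rewrite mem_cat => /orP[/allpairsP[[i j] [_ _ ->]]|/sP//] /=.
  apply: mem_span_of; exists i, j, (val (component GV i v)), (val (component GW j w)).
  by split=> //; apply: valP.
rewrite big_cons big_cat big_allpairs_dep -sE /=; congr (_ + _).
rewrite {1}vE pure_suml; apply: eq_bigr => i _.
by rewrite {1}wE pure_sumr.
Qed.

Definition tensor_grading : grading K (V ⊗ W) :=
  Grading (mk_gradingP tproj_piece tensor_piece_sum).

End TensorGrading.

Section Series.
Variable F : fieldType.

(* A formal series in several variables with coefficients in W is the function
   mapping an exponent vector in Z (Z = int * int or int * int * int below) to
   the corresponding coefficient. The coefficient of a product is a sum over
   all of Z; it is meaningful when only finitely many terms are nonzero. *)
Definition smul (Z : zmodType) (W : lmodType F) (f : Z -> F) (g : Z -> W)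
  (n : Z) : W := \sum_(p \in [set: Z]) f p *: g (n - p).

(* n (n - 1) ... (n - i + 1) / i! for an integer n *)
Definition gbinom (n : int) (i : nat) : F :=
  (\prod_(l < i) (n - (l : nat)%:Z)%:~R) / i`!%:R.

(* the coefficient of u^a v^b in (u + e v)^n, expanded in nonnegative integral
   powers of v *)
Definition binom_series (e : F) (n a b : int) : F :=
  if (0 <= b) && (a + b == n) then e ^+ absz b * gbinom n (absz b) else 0.

(* the coefficient of y^d u^a v^b in
     y^-1 delta ((u + e v) / (e' y)) = \sum_n e'^-n y^(-n-1) (u + e v)^n *)
Definition delta_series (e e' : F) (d a b : int) : F :=
  e' ^ (d + 1) * binom_series e (- d - 1) a b.

(* For A(x1, x2) = \sum_(n, m) A n m x1^n x2^m, the coefficient of x0^a x2^b in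
   A(x0 + x2, x2). *)
Definition shift_series (W : lmodType F) (A : int -> int -> W) (a b : int) : W :=
  \sum_(n \in [set: int]) \sum_(m \in [set: int])
    binom_series 1 n a (b - m) *: A n m.

End Series.

Section Coaction.
Variables (F : fieldType) (V M : lmodType F).

(* The family (Delta_k)_k of linear maps with
   Y(x) w = \sum_k Delta_k(w) x^(-k-1). *)
Definition modes := int -> {linear M -> V ⊗ M}.

(* the coefficient of x^n in Y(x) *)
Definition coefY (D : modes) (n : int) : {linear M -> V ⊗ M} := D (- n - 1).

Definition left_counit (c : {linear V -> F^o}) (D : modes) : Prop :=
  forall w n, tlunit M (tmap c (idfun : {linear M -> M}) (coefY D n w)) =
              if n == 0 then w else 0.

Definition truncation (D : modes) : Prop :=
  forall w, exists N : int, forall n, N < n -> coefY D n w = 0.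

Definition bounded_below (J : numDomainType) (G : grading J M) : Prop :=
  exists N : J, forall k, k < N -> forall w, w \in G k -> w = 0.

(* the coefficient of x1^b x2^c in (Id_V ⊗ Y_M(x2)) Y_M(x1) w *)
Definition iterR (DM : modes) (w : M) (b c : int) : V ⊗ V ⊗ M :=
  tassoc V V M (tmap (idfun : {linear V -> V}) (coefY DM c) (coefY DM b w)).

End Coaction.

Section Jacobi.
Variables (F : fieldType) (V M : lmodType F) (DV : modes V V) (DM : modes V M).

(* the coefficient of x0^a x2^c in (Y_V(x0) ⊗ Id_M) Y_M(x2) w *)
Definition iterL (w : M) (a c : int) : V ⊗ V ⊗ M :=
  tmap (coefY DV a) (idfun : {linear M -> M}) (coefY DM c w).

(* An exponent vector (a, b, c) stands for x0^a x1^b x2^c. *)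
Definition jacobi : Prop := forall (w : M) (n : int * int * int),
  smul (fun '(a, b, c) => delta_series (-1) 1 a b c)
       (fun '(a, b, c) => if a == 0 then iterR DM w b c else 0) n
  - smul (fun '(a, b, c) => delta_series (-1) (-1) a c b)
         (fun '(a, b, c) => if a == 0 then
            tmap (ttwist V V) (idfun : {linear M -> M}) (iterR DM w c b)
          else 0) n
  = smul (fun '(a, b, c) => delta_series (-1) 1 c b a)
         (fun '(a, b, c) => if b == 0 then iterL w a c else 0) n.

End Jacobi.

Record vertexCoalgebra (F : fieldType) := VertexCoalgebra {
  vc_space :> lmodType F;
  vc_Delta : modes vc_space vc_space;
  vc_counit : {linear vc_space -> F^o};
  vc_left_counit : left_counit vc_counit vc_Delta;
  vc_cocreation : forall v n,
    (n < 0 -> trunit vc_space (tmap (idfun : {linear vc_space -> vc_space})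
                                    vc_counit (coefY vc_Delta n v)) = 0) /\
    (n = 0 -> trunit vc_space (tmap (idfun : {linear vc_space -> vc_space})
                                    vc_counit (coefY vc_Delta n v)) = v);
  vc_truncation : truncation vc_Delta;
  vc_jacobi : jacobi vc_Delta vc_Delta
}.

Definition wtZ (i j : int) : int := i + j.
Definition wtQ (i : int) (j : rat) : rat := i%:~R + j.

Record gradedVertexCoalgebra (F : fieldType) := GradedVertexCoalgebra {
  gvc_coalgebra :> vertexCoalgebra F;
  gvc_grading : grading int gvc_coalgebra;
  gvc_bounded : bounded_below gvc_grading;
  gvc_degree : forall (r k : int) v, v \in gvc_grading r ->
    vc_Delta gvc_coalgebra k v
      \in tensor_grading wtZ gvc_grading gvc_grading (r + k + 1)
}.

Record comodule (F : fieldType) (V : gradedVertexCoalgebra F) := Comodule {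
  cm_space :> lmodType F;
  cm_grading : grading rat cm_space;
  cm_bounded : bounded_below cm_grading;
  cm_Delta : modes V cm_space;
  cm_degree : forall (j : rat) (k : int) w, w \in cm_grading j ->
    cm_Delta k w \in
      tensor_grading wtQ (gvc_grading V) cm_grading (j + k%:~R + 1);
  cm_left_counit : left_counit (vc_counit V) cm_Delta;
  cm_truncation : truncation cm_Delta;
  cm_jacobi : jacobi (vc_Delta V) cm_Delta
}.

Definition VVM_grading (F : fieldType) (V : gradedVertexCoalgebra F)
    (M : comodule V) : grading rat (V ⊗ V ⊗ M) :=
  tensor_grading wtQ (tensor_grading wtZ (gvc_grading V) (gvc_grading V))
    (cm_grading M).

(* Main.v *)
Require Import Defs.
From HB Require Import structures.
From mathcomp Require Import all_boot all_order all_algebra.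
From mathcomp Require Import finmap.
From mathcomp Require Import all_classical.
From mathcomp Require Import zify ring lra.

Set Implicit Arguments.
Unset Strict Implicit.
Unset Printing Implicit Defensive.

Import Order.TTheory GRing.Theory Num.Theory.

Local Open Scope ring_scope.

(** Write L(x0, x2) = (Y_V(x0) ⊗ Id) Y_M(x2) w and
    R(x1, x2) = (Id ⊗ Y_M(x2)) Y_M(x1) w.

    Weak coassociativity comes out of the Jacobi identity by multiplying it by
    x1^k and taking the residue in x1, provided that k is so large that the
    middle term, the one with the twist T, contributes nothing.  After pairing
    with v' such a k exists uniformly in w ([pairing_iterR_eq0]): the
    coefficient of x1^n in (T ⊗ Id)(Id ⊗ Y_M(x1)) applied to a tensor of
    weights (i, j) has weight i + j - n; the weights i and j are bounded below,
    while v' sees only finitely many weights, so the pairing vanishes for all n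
    below some -k.  The expansion of delta ((x2 - x1) / (-x0)) only brings in
    nonnegative powers of x1, hence the residue of x1^k times this term is 0.

    What is left is read off coefficientwise at x0^p x1^(-k-1) x2^r.  On the
    right-hand side, delta ((x1 - x0) / x2) gives
      \sum_c 'C(k, c) L(p - k + c, r - c),
    the coefficient of (x0 + x2)^k L(x0, x2) ([smul_delta3E]).  The first term
    gives \sum_s binom(p + s, s) R(p - k + s, r - s) ([smul_delta1E]); the
    coefficient of (x0 + x2)^k R(x0 + x2, x2) is the double sum
      \sum_c \sum_s 'C(k, c) binom(p - k + s, s - c) R(p - k + s, r - s),
    and the two agree by the Vandermonde convolution ([vandermonde]).  This is
    the formal content of (x0 + x2)^k (x0 + x2)^n = (x0 + x2)^(n + k).

    Truncation makes all these sums finite before pairing with v', which is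
    what allows v' to be moved inside them. *)

(** * Sums over infinite index types with finite support *)

Section FiniteSums.

(** All coefficients below are sums over exponent vectors whose support lies on a
    half-line; this turns them into ordinary sums. *)
Lemma fsum_nat (T : choiceType) (W : nmodType) (f : T -> W) (g : nat -> T)
    (N : nat) :
  injective g -> (forall x, (forall i, x <> g i) -> f x = 0) ->
  (forall i, (N <= i)%N -> f (g i) = 0) ->
  \sum_(x \in [set: T]%classic) f x = \sum_(i < N) f (g i).
Proof.
move=> injg fout fN.
pose A : {fset T} := seq_fset tt [seq g i | i <- iota 0 N].
rewrite (fsbigTE A) => [|x xA]; last first.
  have [[i xi]|nx] := pselect (exists i, x = g i); last first.
    by apply: fout => i xi; apply: nx; exists i.
  rewrite xi; apply: fN; rewrite leqNgt; apply: contra xA => iN.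
  by rewrite seq_fsetE xi map_f// mem_iota.
rewrite -(big_mkord xpredT (fun i => f (g i))) /index_iota subn0.
rewrite -[RHS](big_map g xpredT f); apply: perm_big; apply: uniq_perm.
- exact: fset_uniq.
- by rewrite map_inj_uniq// iota_uniq.
- by move=> x; rewrite seq_fsetE.
Qed.

Lemma fsum1 (T : choiceType) (W : nmodType) (f : T -> W) (a : T) :
  (forall x, x != a -> f x = 0) -> \sum_(x \in [set: T]%classic) f x = f a.
Proof.
move=> fa; rewrite (fsbigTE [fset a]%fset) ?big_seq_fset1// => x.
by rewrite in_fset1; exact: fa.
Qed.

(** A sum with infinite support is 0 by convention, and then so is its image. *)
Lemma linear_fsum_eq0 (F : fieldType) (T : choiceType) (W U : lmodType F)
    (phi : {linear W -> U}) (f : T -> W) :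
  (forall x, phi (f x) = 0) -> phi (\sum_(x \in [set: T]%classic) f x) = 0.
Proof. by move=> f0; rewrite linear_sum big1. Qed.

End FiniteSums.

(** * Binomial coefficients with an integer upper index *)

Section Binomials.
Variable F : fieldType.
Hypothesis charF0 : [pchar F] =i pred0.

Let natF_neq0 n : (n.+1)%:R != 0 :> F.
Proof. by move/pcharf0P: charF0 => ->. Qed.

Let fact_neq0 n : (n`!)%:R != 0 :> F.
Proof. by move/pcharf0P: charF0 => ->; rewrite -lt0n fact_gt0. Qed.

Lemma gbinom0 (n : int) : gbinom F n 0 = 1.
Proof. by rewrite /gbinom big_ord0 fact0 divr1. Qed.

(** Pascal's rule; this is where the invertibility of factorials is used. *)
Lemma gbinomS (n : int) i :
  gbinom F (n + 1) i.+1 = gbinom F n i.+1 + gbinom F n i.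
Proof.
rewrite /gbinom big_ord_recl big_ord_recr /=.
rewrite (eq_bigr (fun l : 'I_i => (n - (l : nat)%:Z)%:~R)) => [|l _]; last first.
  by congr (_%:~R); rewrite /bump /=; lia.
set P := \prod_(_ < _) _; rewrite factS natrM.
have := fact_neq0 i; have := natF_neq0 i; set f := (i`!)%:R; move=> i0 f0.
rewrite !rmorphB rmorphD /= -!pmulrn -natr1 in i0 *.
by field; rewrite i0 f0.
Qed.

Lemma gbinom_nat (k i : nat) : gbinom F k%:Z i = 'C(k, i)%:R.
Proof.
elim: k i => [|k ih] [|i]; rewrite ?gbinom0 ?bin0//.
  by rewrite /gbinom big_ord_recl subr0 mul0r mul0r bin0n.
by rewrite -addn1 PoszD gbinomS !ih addn1 binS natrD.
Qed.

(** Upper negation.  It identifies the coefficients of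
    delta ((x1 - x2) / x0) and delta ((x1 - x0) / x2), which involve negative
    exponents, with those of powers of x0 + x2. *)
Lemma gbinomN (p : int) i :
  (-1) ^+ i * gbinom F (- p - 1) i = gbinom F (p + i%:Z) i.
Proof.
rewrite /gbinom mulrA; congr (_ / _).
rewrite [RHS](reindex_inj rev_ord_inj) /=.
have -> : (-1) ^+ i = \prod_(l < i) (-1 : F) by rewrite prodr_const card_ord.
rewrite -big_split; apply: eq_bigr => l _ /=.
by rewrite mulN1r -rmorphN; congr (_%:~R); have := ltn_ord l; lia.
Qed.

Lemma binom_seriesE (e : F) (n a : int) (i : nat) : a + i%:Z = n ->
  binom_series e n a i%:Z = e ^+ i * gbinom F n i.
Proof. by move=> <-; rewrite /binom_series eqxx. Qed.

Lemma binom_series_eq0 (e : F) (n a b : int) :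
  (forall i : nat, b = i%:Z -> a + i%:Z <> n) -> binom_series e n a b = 0.
Proof.
move=> h; rewrite /binom_series; case: b h => // i h.
by case: eqP => //= /h; case.
Qed.

Lemma sum_binS (f : nat -> F) (k : nat) :
  \sum_(c < k.+2) 'C(k.+1, c)%:R * f c
  = \sum_(c < k.+1) 'C(k, c)%:R * (f c + f c.+1).
Proof.
under [RHS]eq_bigr do rewrite mulrDr.
rewrite big_split /= big_ord_recl /=.
under eq_bigr do rewrite /bump /= add1n binS natrD mulrDl.
rewrite big_split /= addrA; congr (_ + _).
rewrite big_ord_recr/= (bin_small (ltnSn k)) mul0r addr0.
by rewrite [RHS]big_ord_recl !bin0.
Qed.

(** Comparison of coefficients in (u + v)^k (u + v)^x = (u + v)^(x + k).  The
    lower index s - c is an integer, so [binom_series] is used in place of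
    [gbinom]: it vanishes when that index is negative.  Induction on k, each
    factor u + v being absorbed into (u + v)^x by Pascal's rule. *)
Lemma vandermonde (k : nat) (x s : int) :
  \sum_(c < k.+1) 'C(k, c)%:R * binom_series 1 x (x - (s - c%:Z)) (s - c%:Z)
  = binom_series 1 (x + k%:Z) (x + k%:Z - s) s :> F.
Proof.
elim: k x => [|k ih] x; first by rewrite big_ord1 bin0 mul1r subr0 !addr0.
rewrite (sum_binS (fun c => binom_series 1 x (x - (s - c%:Z)) (s - c%:Z))).
rewrite -(_ : x + 1 + k%:Z = x + k.+1%:Z) -?ih; last by lia.
apply: eq_bigr => c _; congr (_ * _).
have E n j : binom_series 1 n (n - j) j = if 0 <= j then gbinom F n `|j|%N else 0.
  by rewrite /binom_series expr1n mul1r subrK eqxx andbT.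
rewrite !E; case sc: (s - c%:Z) => [[|j]|j].
- by rewrite (_ : (0 <= s - c.+1%:Z) = false) ?gbinom0 ?addr0//; lia.
- rewrite (_ : s - c.+1%:Z = j%:Z); last by lia.
  by rewrite /= gbinomS.
- by rewrite (_ : (0 <= s - c.+1%:Z) = false) ?addr0//; lia.
Qed.

End Binomials.

(** * Coefficients of the products in the Jacobi identity *)

Section Expansions.
Variables (F : fieldType) (W : lmodType F).

(** The base point [n0] of the summation is free, so that shifted series with
    different [a] can be written as sums over one common range of exponents. *)
Lemma shift_seriesE (A : int -> int -> W) (a b n0 : int) (N : nat) :
  n0 <= a -> (forall n, n0 + N%:Z <= n -> forall m, A n m = 0) ->
  shift_series A a b = \sum_(s < N)
    binom_series 1 (n0 + s%:Z) a (n0 + s%:Z - a)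
      *: A (n0 + s%:Z) (a + b - n0 - s%:Z).
Proof.
move=> n0a A0; rewrite /shift_series.
(* For a given power x1^n of A(x1, x2), only one power of x2 contributes. *)
have inner n : \sum_(m \in [set: int]%classic)
    binom_series 1 n a (b - m) *: A n m
    = binom_series 1 n a (n - a) *: A n (a + b - n).
  rewrite (@fsum1 _ _ _ (a + b - n)) => [|m mn].
    by congr (binom_series _ _ _ _ *: _); lia.
  rewrite binom_series_eq0 ?scale0r// => i bi ai.
  by case/eqP: mn; lia.
under eq_fsbigr do rewrite inner.
rewrite (@fsum_nat _ _ _ (fun s : nat => n0 + s%:Z) N).
- by apply: eq_bigr => s _; congr (_ *: A _ _); lia.
- by move=> s t /addrI [].
- move=> n nE; rewrite binom_series_eq0 ?scale0r// => i ni _.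
  by apply: (nE `|n - n0|%N); lia.
- by move=> s Ns; rewrite A0 ?scaler0//; lia.
Qed.

Hypothesis charF0 : [pchar F] =i pred0.

Lemma smul_binomE (k : nat) (g : int -> int -> W) (p r : int) :
  smul (fun '(a, c) => binom_series 1 k%:Z a c) (fun '(a, c) => g a c) (p, r)
  = \sum_(c < k.+1) 'C(k, c)%:R *: g (p - k%:Z + c%:Z) (r - c%:Z).
Proof.
rewrite /smul (@fsum_nat _ _ _ (fun c : nat => (k%:Z - c%:Z, c%:Z)) k.+1).
- apply: eq_bigr => c _ /=; rewrite binom_seriesE ?subrK//.
  by rewrite expr1n mul1r gbinom_nat//; congr (_ *: g _ _); lia.
- by move=> c d [].
- move=> [a c] acE; rewrite binom_series_eq0 ?scale0r// => i ci ai.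
  by apply: (acE i); rewrite ci; congr pair; lia.
- move=> c kc /=; rewrite binom_seriesE ?subrK// gbinom_nat// bin_small//.
  by rewrite mulr0 scale0r.
Qed.

(** Here delta ((x1 - x2) / x0) fixes the exponent of x0 to p, and [gbinomN]
    turns (-1)^i binom(-p-1, i) into binom(p + i, i). *)
Lemma smul_delta1E (A : int -> int -> W) (p q r : int) (N : nat) :
  (forall n, q + p + 1 + N%:Z <= n -> forall m, A n m = 0) ->
  smul (fun '(a, b, c) => delta_series (-1) 1 a b c)
       (fun '(a, b, c) => if a == 0 then A b c else 0) (p, q, r)
  = \sum_(i < N) gbinom F (p + i%:Z) i *: A (q + p + 1 + i%:Z) (r - i%:Z).
Proof.
move=> A0.
rewrite /smul (@fsum_nat _ _ _ (fun i : nat => (p, - p - 1 - i%:Z, i%:Z)) N).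
- apply: eq_bigr => i _ /=; rewrite subrr eqxx /delta_series exp1rz mul1r.
  by rewrite binom_seriesE ?subrK// gbinomN; congr (_ *: A _ _); lia.
- by move=> i j [].
- move=> [[a b] c] nE /=; case: eqP => pa; last by rewrite scaler0.
  rewrite /delta_series binom_series_eq0 ?mulr0 ?scale0r// => i ci bi.
  by apply: (nE i); rewrite ci; congr (_, _, _); lia.
- by move=> i Ni /=; rewrite subrr eqxx A0 ?scaler0//; lia.
Qed.

(** At the exponent -k-1 of x1, that is, for the residue in x1 after
    multiplication by x1^k, delta ((x1 - x0) / x2) acts as the polynomial
    (x0 + x2)^k: its coefficients (-1)^a binom(a-k-1, a) are 'C(k, a). *)
Lemma smul_delta3E (k : nat) (B : int -> int -> W) (p r : int) :
  smul (fun '(a, b, c) => delta_series (-1) 1 c b a)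
       (fun '(a, b, c) => if b == 0 then B a c else 0) (p, - k%:Z - 1, r)
  = \sum_(c < k.+1) 'C(k, c)%:R *: B (p - k%:Z + c%:Z) (r - c%:Z).
Proof.
rewrite /smul.
have coefE (a : nat) :
    delta_series (-1) 1 (k%:Z - a%:Z) (- k%:Z - 1) a%:Z = 'C(k, a)%:R :> F.
  rewrite /delta_series exp1rz mul1r.
  rewrite binom_seriesE; last by lia.
  by rewrite gbinomN subrK gbinom_nat.
rewrite (@fsum_nat _ _ _
  (fun a : nat => (a%:Z, - k%:Z - 1, k%:Z - a%:Z)) k.+1).
- rewrite [RHS](reindex_inj rev_ord_inj); apply: eq_bigr => a _ /=.
  have ak : (a <= k)%N by rewrite -ltnS.
  rewrite subrr eqxx coefE subSS bin_sub//.
  by congr (_ *: B _ _); lia.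
- by move=> a b [].
- move=> [[a b] c] nE /=; case: eqP => qb; last by rewrite scaler0.
  rewrite /delta_series binom_series_eq0 ?mulr0 ?scale0r// => i ai bi.
  by apply: (nE i); rewrite ai; congr (_, _, _); lia.
- move=> a ka /=.
  by rewrite subrr eqxx coefE bin_small// scale0r.
Qed.

End Expansions.

(** * Weak coassociativity from the Jacobi identity *)

Section WeakCoassociativity.
Variables (F : fieldType) (V M : lmodType F) (DV : modes V V) (DM : modes V M).
Hypothesis charF0 : [pchar F] =i pred0.
Variables (U : lmodType F) (phi : {linear V ⊗ V ⊗ M -> U}) (k : nat).

(** The residue argument, for any linear map [phi] that bounds from below the
    exponents of x1 in the twisted term. *)
Lemma jacobi_weak_coassociativity : truncation DM -> jacobi DV DM ->
  (forall w b c, c < - k%:Z ->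
     phi (tmap (ttwist V V) (idfun : {linear M -> M}) (iterR DM w b c)) = 0) ->
  forall w n,
    smul (fun '(a, c) => binom_series 1 k%:Z a c)
         (fun '(a, c) => phi (iterL DV DM w a c
                              - shift_series (iterR DM w) a c)) n = 0.
Proof.
move=> truncM jac lower w [p r]; have [N0 N0P] := truncM w.
pose N := absz (N0 - p + k%:Z + 1).
have R0 n : p - k%:Z + N%:Z <= n -> forall m, iterR DM w n m = 0.
  by move=> Nn m; rewrite /iterR N0P ?linear0//; rewrite /N in Nn; lia.
(* In the twisted term the exponent of x1 is at most -k-1, where phi is 0. *)
have := congr1 phi (jac w (p, - k%:Z - 1, r)).
rewrite linearB [X in _ - X](_ : _ = 0) ?subr0; last first.
  apply: linear_fsum_eq0 => -[[a b] c]; rewrite linearZ.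
  change (delta_series (-1) (-1) a c b *: phi (if p - a == 0 then
    tmap (ttwist V V) (idfun : {linear M -> M})
      (iterR DM w (r - c) (- k%:Z - 1 - b))
    else 0) = 0).
  case: ifP => _; last by rewrite linear0 scaler0.
  rewrite /delta_series /binom_series; case: ifP => [/andP[b0 _]|_]; last first.
    by rewrite mulr0 scale0r.
  by rewrite lower ?scaler0//; lia.
rewrite (smul_delta3E charF0) (@smul_delta1E _ _ _ _ _ _ N); last first.
  by move=> n Nn m; apply: R0; lia.
rewrite !linear_sum /= => jacE.
rewrite (smul_binomE charF0 k (fun a c => phi (iterL DV DM w a c
                              - shift_series (iterR DM w) a c))).
(* All the shifted series are summed over the same exponents p - k + s. *)
have shE (c : 'I_k.+1) :
    phi (shift_series (iterR DM w) (p - k%:Z + c%:Z) (r - c%:Z))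
    = \sum_(s < N) binom_series 1 (p - k%:Z + s%:Z)
        (p - k%:Z + s%:Z - (s%:Z - c%:Z)) (s%:Z - c%:Z)
        *: phi (iterR DM w (p - k%:Z + s%:Z) (r - s%:Z)).
  rewrite (@shift_seriesE _ _ _ _ _ (p - k%:Z) N)//; last by lia.
  rewrite linear_sum; apply: eq_bigr => s _; rewrite linearZ /=.
  by congr (binom_series _ _ _ _ *: phi (iterR _ _ _ _)); lia.
under eq_bigr do rewrite linearB /= scalerBr shE.
rewrite sumrB; apply/eqP; rewrite subr_eq0; apply/eqP.
under eq_bigr do rewrite -linearZ.
rewrite -jacE.
under [RHS]eq_bigr do rewrite scaler_sumr.
rewrite exchange_big /=; apply: eq_bigr => s _.
(* The coefficient of each R(p - k + s, r - s) is a Vandermonde sum. *)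
under eq_bigr do rewrite scalerA.
rewrite -scaler_suml vandermonde// linearZ /=.
rewrite binom_seriesE; last by rewrite subrK.
by rewrite expr1n mul1r; congr (gbinom F _ s *: phi (iterR _ _ _ _)); lia.
Qed.

End WeakCoassociativity.

(** * Weights and the pairing with the graded dual *)

Section Pairing.
Variables (F : fieldType) (I : choiceType) (W : lmodType F) (G : grading I W).
Variable f : graded_dual G.

Lemma pairing_linear : linear (pairing f).
Proof.
move=> a x y; have [A [xA yA]] := component_supp2 G x y.
have pE z : (forall k, k \notin A -> component G k z = 0) ->
    pairing f z = \sum_(k <- A) f k (component G k z).
  by move=> zA; apply: fsbigTE => k /zA ->; rewrite linear0.
rewrite !pE//; last by move=> k kA; rewrite linearP /= xA// yA// scaler0 addr0.
by rewrite scaler_sumr -big_split; apply: eq_bigr => k _; rewrite !linearP.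
Qed.

HB.instance Definition _ :=
  GRing.isLinear.Build F W F^o *:%R (pairing f) pairing_linear.

Lemma pairing_piece_eq0 k w : (forall u, f k u = 0) -> w \in G k ->
  pairing f w = 0.
Proof.
move=> fk0 wk; rewrite /pairing fsbig1// => j _.
have [->//|jk] := eqVneq j k.
rewrite (_ : component G j w = 0) ?linear0//; apply: val_inj.
by rewrite (component_piece wk) (negbTE jk).
Qed.

End Pairing.

Lemma graded_dual_bounded (F : fieldType) (J : realDomainType) (W : lmodType F)
    (G : grading J W) (f : graded_dual G) :
  exists B : J, forall k, B < k -> forall u, f k u = 0.
Proof.
have /finite_fsetP[A eA] := dual_finite f.
have [B BA] : exists B : J, forall k, k \in (A : seq J) -> k <= B.
  elim: (A : seq J) => [|a s [B Bs]]; first by exists 0.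
  exists (Num.max a B) => k; rewrite inE le_max => /orP[/eqP->|/Bs ->].
    by rewrite lexx.
  by rewrite orbT.
exists B => k Bk u; apply/eqP/negPn/negP => fku.
have : [set k | exists w, f k w != 0]%classic k by exists u.
by rewrite eA => /BA; rewrite leNgt Bk.
Qed.

Section TensorVanishing.
Variables (F : fieldType) (I J K : choiceType) (V W U : lmodType F).
Variables (wt : I -> J -> K) (GV : grading I V) (GW : grading J W).
Variable phi : {linear V ⊗ W -> U}.

Lemma tensor_piece_eq0 k :
  (forall i j v w, wt i j = k -> v \in GV i -> w \in GW j -> phi (v ⊗ₜ w) = 0) ->
  forall x, x \in tensor_grading wt GV GW k -> phi x = 0.
Proof.
move=> phi0 x /asboolP[s [sP ->]]; rewrite linear_sum big_seq big1// => p /sP.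
by move=> [i [j [v [w [ij vi wj ->]]]]]; rewrite linearZ /= (phi0 i j) ?scaler0.
Qed.

Lemma tensor_homogeneous_eq0 :
  (forall i j v w, v \in GV i -> w \in GW j -> phi (v ⊗ₜ w) = 0) ->
  forall x, phi x = 0.
Proof.
move=> phi0 x; have [s [sP ->]] := tensor_piece_sum wt GV GW x.
rewrite linear_sum big_seq big1// => p /sP.
by apply: tensor_piece_eq0 => i j v w _; apply: phi0.
Qed.

End TensorVanishing.

HB.instance Definition _ (F : fieldType) (V W : lmodType F) (v : V) :=
  GRing.isLinear.Build F W (V ⊗ W) *:%R (tpure v) ((tpure_bilinear V W).2 v).

(** The bound on the exponent of x1 is uniform in w because it only depends on
    the weights occurring in v' and on the lower bounds for the weights of V and
    M: the weight of Y_M(x2) w, whatever it is, is spread over tensor factors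
    whose weights are bounded below, and applying the coefficient of x1^c
    changes the total weight by -c. *)
Lemma pairing_iterR_eq0 (F : fieldType) (V : gradedVertexCoalgebra F)
    (M : comodule V) (v' : graded_dual (VVM_grading M)) :
  exists2 k : nat, (0 < k)%N & forall (w : M) (b c : int), c < - k%:Z ->
    pairing v' (tmap (ttwist V V) (idfun : {linear M -> M})
                  (iterR (cm_Delta M) w b c)) = 0.
Proof.
have [B v'B] := graded_dual_bounded v'.
have [NV NVP] := gvc_bounded V; have [NM NMP] := cm_bounded M.
(* Then B < NV + NM - c as soon as c < -k. *)
pose k := (Num.bound `|B - NV%:~R - NM|).+1.
exists k => // w b c ck; rewrite /iterR.
move: (coefY _ b w); apply: (tensor_homogeneous_eq0 wtQ
  (GV := gvc_grading V) (GW := cm_grading M)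
  (phi := (pairing v' \o tmap (ttwist V V) (idfun : {linear M -> M})
     \o tassoc V V M \o tmap (idfun : {linear V -> V}) (coefY (cm_Delta M) c)
       : {linear _ -> _}))) => i j v m vi mj /=.
have [iNV|iNV] := ltP i NV.
  by rewrite (NVP _ iNV _ vi) pure0l !linear0.
have [jNM|jNM] := ltP j NM.
  by rewrite (NMP _ jNM _ mj) pure0r !linear0.
rewrite tliftE /=; have := cm_degree (- c - 1) mj; rewrite -/(coefY _ c).
move: (coefY _ c m).
apply: (tensor_piece_eq0
  (phi := (pairing v' \o tmap (ttwist V V) (idfun : {linear M -> M})
     \o tassoc V V M \o tpure v : {linear _ -> _}))) => i2 j2 v2 m2 E v2i m2j /=.
rewrite !tliftE /=.
apply: (@pairing_piece_eq0 _ _ _ _ _ (wtQ (wtZ i2 i) j2)).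
  apply: v'B.
  rewrite /wtQ /wtZ in E *; rewrite !rmorphD.
  have : `|B - NV%:~R - NM| < k%:R - 1.
    by rewrite -[k%:R]natr1 addrK archi_boundP.
  have : (NV%:~R : rat) <= i%:~R by rewrite ler_int.
  have : (c%:~R : rat) < - k%:R by rewrite pmulrn -rmorphN ltr_int.
  have := ler_norm (B - NV%:~R - NM).
  move: E; rewrite rmorphB rmorphN /=.
  lra.
apply: mem_span_of; exists (wtZ i2 i), j2, (v2 ⊗ₜ v), m2; split=> //.
by apply: mem_span_of; exists i2, i, v2, v.
Qed.

Theorem proposition4p5 (F : fieldType) (charF0 : [pchar F] =i pred0)
    (V : gradedVertexCoalgebra F) (M : comodule V)
    (v' : graded_dual (VVM_grading M)) :
  exists2 k : int, 0 < k & forall (w : M) (n : int * int),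
    smul (fun '(a, c) => binom_series 1 k a c)
         (fun '(a, c) => pairing v' (iterL (vc_Delta V) (cm_Delta M) w a c
                                     - shift_series (iterR (cm_Delta M) w) a c))
         n = 0.
Proof.
have [k k0 v'0] := pairing_iterR_eq0 v'.
exists k%:Z => //.
apply: (jacobi_weak_coassociativity charF0 (phi := pairing v')) => //.
- exact: cm_truncation.
- exact: cm_jacobi.
Qed.
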